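(* The following are equivalent for a matroid $M$: (i) $M$ is binary. (ii) For any basis $B$ of $M$, whenever an element $b\in B$ is replaced by an element $x\notin B$ to obtain a basis $B_{b,x}=B-b+x$, then for any $y\notin B$, $y\neq x$, such that $b\in C(y,B)$, we have $C(y,B_{b,x})=C(x,B)\bigtriangleup C(y,B)$.
   Context: Matroids have a finite ground set. For a set $X$ and an element $x$, $X+x=X\cup\{x\}$ and $X-x=X\setminus\{x\}$. For a basis $B$ of $M$ and an element $y\notin B$ of the ground set, $C(y,B)$ denotes the unique circuit contained in $B+y$. $X\bigtriangleup Y=(X\setminus Y)\cup(Y\setminus X)$ denotes symmetric difference. A matroid is binary if it is representable over the two-element field. *)

(* Defs.v *)
From mathcomp Require Import all_boot all_order all_algebra.

Set Implicit Arguments.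
Unset Strict Implicit.
Unset Printing Implicit Defensive.

Local Open Scope ring_scope.

(* The ground set is the whole finite type [T]. *)
Record matroid (T : finType) := Matroid {
  indep : pred {set T};
  indep0 : indep set0;
  indepS : forall A B : {set T}, A \subset B -> indep B -> indep A;
  indep_aug : forall A B : {set T}, indep A -> indep B -> (#|A| < #|B|)%N ->
    exists2 x, x \in B :\: A & indep (x |: A)
}.

Definition basis (T : finType) (M : matroid T) (B : {set T}) : bool :=
  maxset (indep M) B.

Definition circuit (T : finType) (M : matroid T) (C : {set T}) : bool :=
  minset [pred A | ~~ indep M A] C.

(* Only meaningful when [B] is a basis and [y \notin B]; [fcircuitP] and
   [fcircuit_unique] show that it is then the unique circuit inside
   [y |: B]. *)
Definition fcircuit (T : finType) (M : matroid T) (y : T) (B : {set T}) :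
    {set T} :=
  odflt set0 [pick C : {set T} | circuit M C && (C \subset y |: B)].

(* The vectors form a family indexed by [T]: distinct elements with equal
   vectors are dependent, since [free] rejects repetitions. *)
Definition representable (F : fieldType) (T : finType) (M : matroid T) : Prop :=
  exists (n : nat) (v : T -> 'rV[F]_n),
    forall A : {set T}, indep M A = free [seq v x | x <- enum A].

Definition binary (T : finType) (M : matroid T) : Prop :=
  representable 'F_2 M.

Definition symdiff (T : finType) (A B : {set T}) : {set T} :=
  (A :\: B) :|: (B :\: A).

Lemma fcircuitP (T : finType) (M : matroid T) (y : T) (B : {set T}) :
  basis M B -> y \notin B ->
  circuit M (fcircuit M y B) /\ fcircuit M y B \subset y |: B.
Proof.
move=> /maxsetP[_ Bmax] yB; rewrite /fcircuit; case: pickP => [C /andP[]//|noC].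
have dep : [pred A | ~~ indep M A] (y |: B).
  apply/negP => iyB; have /setP/(_ y) := Bmax _ iyB (subsetUr _ _).
  by rewrite setU11 (negPf yB).
have [C mC sC] := minset_exists dep.
by have := noC C; rewrite /circuit mC sC.
Qed.

Lemma fcircuit_unique (T : finType) (M : matroid T) (y : T) (B C : {set T}) :
  basis M B -> y \notin B -> circuit M C -> C \subset y |: B ->
  C = fcircuit M y B.
Proof.
move=> bB yB cC sC; have [] := fcircuitP bB yB.
move: (fcircuit _ _ _) => D cD sD; apply/eqP/negPn/negP => neqCD.
have /maxsetP[iB _] := bB.
have [/minsetP[/= nC minC] /minsetP[/= nD minD]] := (cC, cD).
have /subsetPn[e eC eD] : ~~ (C \subset D).
  by apply: contra neqCD => sCD; apply/eqP/minD.
have iCe : indep M (C :\ e).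
  apply/negPn/negP => nCe; have /setP/(_ e) := minC _ nCe (subsetDl _ _).
  by rewrite !inE eqxx eC.
pose P := [pred J | indep M J && (J \subset y |: B)].
have PCe : P (C :\ e) by rewrite /= iCe (subset_trans (subsetDl _ _) sC).
have [J /maxsetP[/andP[iJ sJ] maxJ] sCJ] := maxset_exists PCe.
have leBJ : (#|B| <= #|J|)%N.
  rewrite leqNgt; apply/negP => ltJB; have [x] := indep_aug iJ iB ltJB.
  rewrite inE => /andP[xJ xB] ixJ; case/negP: xJ.
  rewrite -(maxJ (x |: J)) ?setU11 ?subsetUr //= ixJ.
  by rewrite subUset sub1set sJ inE xB orbT.
have eJ : e \notin J.
  apply: contra nC => eJ; apply: indepS iJ.
  by rewrite -(setD1K eC) subUset sub1set eJ.
have eyB : e \in y |: B by apply: (subsetP sC).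
have JE : J = (y |: B) :\ e.
  apply/eqP; rewrite eqEcard subsetD1 sJ eJ /=.
  by have := cardsD1 e (y |: B); rewrite eyB cardsU1 yB !add1n => -[<-].
case/negP: nD; apply: indepS iJ.
by rewrite JE subsetD1 sD.
Qed.

(* Main.v *)
Require Import Defs.
From mathcomp Require Import all_boot all_order all_algebra.

Set Implicit Arguments.
Unset Strict Implicit.

(** Over the two-element field, a set is free iff no nonempty subset of it has
    sum zero, so the circuits of a binary matroid sum to zero and symmetric
    differences of zero-sum sets are zero-sum; as [y |: B] contains only one
    nonempty zero-sum set, (i) implies (ii).  Conversely, fix a basis [B0], send
    its elements to unit vectors and every other [y] to the sum of
    [fcircuit M y B0 :\ y].  The property "[B] is free and all its fundamental
    circuits sum to zero" holds for [B0] and, by (ii), survives a basis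
    exchange, hence holds for all bases.  Every circuit is fundamental for some
    basis, so these vectors represent [M]. *)

Import GRing.Theory.
Local Open Scope ring_scope.

(** * Bases, exchange and fundamental circuits in an arbitrary matroid *)

Section Matroid.
Variables (T : finType) (M : matroid T).
Implicit Types A B C : {set T}.

Lemma basis_indep B : basis M B -> indep M B.
Proof. by case/maxsetP. Qed.

Lemma indep_card_basis A B : indep M A -> basis M B -> (#|A| <= #|B|)%N.
Proof.
move=> iA /maxsetP[iB maxB]; rewrite leqNgt; apply/negP => ltBA.
have [x] := indep_aug iB iA ltBA; rewrite inE => /andP[/negP xB _] ixB.
by apply: xB; rewrite -(maxB _ ixB (subsetUr _ _)) setU11.
Qed.

Lemma basis_card_indep A B :
  basis M B -> indep M A -> (#|B| <= #|A|)%N -> basis M A.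
Proof.
move=> bB iA leBA; apply/maxsetP; split=> // D iD sAD; apply/esym/eqP.
by rewrite eqEcard sAD (leq_trans (indep_card_basis iD bB)).
Qed.

(** Augmenting the smaller set [B1 :\ b] from [B2] restores the size of a basis; the new element
    cannot be [b], which [B2] lacks. *)
Lemma basis_exchange B1 B2 b : basis M B1 -> basis M B2 -> b \in B1 :\: B2 ->
  exists2 x, x \in B2 :\: B1 & basis M (x |: (B1 :\ b)).
Proof.
move=> b1 b2; rewrite inE => /andP[bB2 bB1].
have cB1 := cardsD1 b B1; rewrite bB1 add1n in cB1.
have iB1b : indep M (B1 :\ b) := indepS (subsetDl _ _) (basis_indep b1).
have [|x] := indep_aug iB1b (basis_indep b2).
  by rewrite -cB1; apply: indep_card_basis (basis_indep b1) b2.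
rewrite inE => /andP[xB1b xB2] ix.
have nxb : x != b by apply: contraNneq bB2 => <-.
exists x; first by move: xB1b; rewrite !inE nxb xB2 andbT.
by apply: basis_card_indep b1 ix _; rewrite cardsU1 xB1b cB1.
Qed.

Lemma circuit_dep C : circuit M C -> ~~ indep M C.
Proof. by case/minsetP. Qed.

Lemma circuit_indepD1 C e : circuit M C -> e \in C -> indep M (C :\ e).
Proof.
case/minsetP=> _ minC eC; apply/negPn/negP => nCe.
by have /setP/(_ e) := minC _ nCe (subsetDl _ _); rewrite !inE eqxx eC.
Qed.

Lemma fcircuit_circuit B y :
  basis M B -> y \notin B -> circuit M (fcircuit M y B).
Proof. by move=> bB yB; case: (fcircuitP bB yB). Qed.

Lemma fcircuit_sub B y :
  basis M B -> y \notin B -> fcircuit M y B \subset y |: B.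
Proof. by move=> bB yB; case: (fcircuitP bB yB). Qed.

Lemma mem_circuit_setU1 A C y :
  indep M A -> circuit M C -> C \subset y |: A -> y \in C.
Proof.
move=> iA cC sC; apply: contraNT (circuit_dep cC) => yC; apply: indepS iA.
apply/subsetP=> z zC; have := subsetP sC z zC.
by rewrite !inE => /predU1P[zy|//]; rewrite -zy zC in yC.
Qed.

Lemma mem_fcircuit B y : basis M B -> y \notin B -> y \in fcircuit M y B.
Proof.
move=> bB yB; apply: mem_circuit_setU1 (basis_indep bB) _ _.
  exact: fcircuit_circuit.
exact: fcircuit_sub.
Qed.

(** The sets [x |: B] and [b |: (x |: (B :\ b))] coincide, so a circuit inside them must contain
    [b], the second being a basis plus [b]. *)
Lemma mem_fcircuit_exchange B b x :
  basis M B -> b \in B -> x \notin B -> basis M (x |: (B :\ b)) ->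
  b \in fcircuit M x B.
Proof.
move=> bB bB0 xB bB'; apply: mem_circuit_setU1 (basis_indep bB') _ _.
  exact: fcircuit_circuit.
by rewrite setUCA setD1K //; apply: fcircuit_sub.
Qed.

(** Removing any [e] from [C] leaves an independent set; a basis extending it misses [e], since
    otherwise it would contain [C]. *)
Lemma circuit_fundamental C : circuit M C ->
  exists B e, [/\ basis M B, e \notin B & C = fcircuit M e B].
Proof.
move=> cC; have [C0|[e eC]] := set_0Vmem C.
  by move: (circuit_dep cC); rewrite C0 indep0.
have [B bB sB] := maxset_exists (circuit_indepD1 cC eC).
have sC : C \subset e |: B by rewrite -(setD1K eC) setUS.
have eB : e \notin B.
  apply: contra (circuit_dep cC) => eB; apply: indepS (basis_indep bB).
  by rewrite -(setD1K eC) subUset sub1set eB.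
by exists B, e; split=> //; apply: fcircuit_unique.
Qed.

End Matroid.

(** * Linear independence over the two-element field through subset sums *)

Section ZeroSum.
Variables (T : finType) (n : nat) (v : T -> 'rV['F_2]_n).
Implicit Types A B D : {set T}.

Definition vsum D := \sum_(x in D) v x.

Definition zero_sum_free A :=
  forall D, D \subset A -> vsum D = 0 -> D = set0.

Lemma addvv_F2 (u : 'rV['F_2]_n) : u + u = 0.
Proof. by apply/rowP=> j; rewrite !mxE addrr_pchar2 // pchar_Fp. Qed.

Lemma F2_nat (k : 'F_2) : k = (k != 0)%:R.
Proof. by case: k => [[|[|k]] ltk] //; apply/val_inj. Qed.

(** The common part is counted twice on the right and vanishes in characteristic 2. *)
Lemma vsum_symdiff A B : vsum (symdiff A B) = vsum A + vsum B.
Proof.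
have vsumID C D : vsum C = vsum (C :&: D) + vsum (C :\: D).
  exact: big_setID.
rewrite (vsumID A B) (vsumID B A) (setIC B A) addrACA addvv_F2 add0r.
rewrite (vsumID _ A); congr (vsum _ + vsum _);
  by apply/setP=> z; rewrite !inE; do 2!case: (z \in _).
Qed.

(** Coefficients are 0 or 1, so a linear relation is the sum over its support. Indexing by [T] makes
    two elements with equal vectors a zero-sum pair. *)
Lemma free_zero_sum_free A :
  reflect (zero_sum_free A) (free [seq v x | x <- enum A]).
Proof.
have sz : size [seq v x | x <- enum A] == #|A| by rewrite size_map -cardE.
pose X := Tuple sz.
have XE (i : 'I_#|A|) : X`_i = v (enum_val i).
  by rewrite /= (nth_map (enum_default i)) -?cardE.
have sumE (k : 'I_#|A| -> 'F_2) D : D \subset A ->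
    (forall i, k i = (enum_val i \in D)%:R) ->
    \sum_(i < #|A|) k i *: X`_i = vsum D.
  move=> sDA kE; rewrite /vsum -(setIidPr sDA).
  under [RHS]eq_bigl do rewrite inE.
  rewrite big_enum_val_cond /= [RHS]big_mkcond.
  by apply: eq_bigr => i _; rewrite kE XE; case: ifP; rewrite ?scale1r ?scale0r.
apply: (iffP (freeP (X := X))) => [freeX D sDA D0|freeA k k0 i].
  apply/setP=> z; rewrite inE; apply/negP => zD.
  have zA := subsetP sDA z zD.
  have := freeX (fun i => (enum_val i \in D)%:R).
  rewrite (sumE _ D) // => /(_ D0 (enum_rank_in zA z)).
  by rewrite enum_rankK_in // zD => /eqP; rewrite oner_eq0.
pose D := [set enum_val j | j in [set j : 'I_#|A| | k j != 0]].
have kE j : k j = (enum_val j \in D)%:R.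
  by rewrite mem_imset ?inE -?F2_nat //; apply: enum_val_inj.
have sDA : D \subset A by apply/subsetP=> _ /imsetP[j _ ->]; apply: enum_valP.
by rewrite kE (freeA D sDA) ?inE // -(sumE k D).
Qed.

End ZeroSum.

(** * From a binary representation to the exchange rule *)

Lemma binary_fcircuit_exchange (T : finType) (M : matroid T) (B : {set T})
    (b x y : T) :
  binary M -> basis M B -> b \in B -> x \notin B -> basis M (x |: (B :\ b)) ->
  y \notin B -> y != x -> b \in fcircuit M y B ->
  fcircuit M y (x |: (B :\ b)) = symdiff (fcircuit M x B) (fcircuit M y B).
Proof.
case=> n [v indepE] bB bB0 xB bB' yB nyx bCy.
have indepP A : reflect (zero_sum_free v A) (indep M A).
  by rewrite indepE; apply: free_zero_sum_free.
(* A nonempty zero-sum subset of a circuit is dependent, hence by minimality the whole circuit. *)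
have circuit0 C : circuit M C -> vsum v C = 0.
  case/minsetP=> /= nC minC; apply/eqP; apply: contraNT nC => /eqP C0.
  apply/indepP => D sDC D0; apply/eqP; apply: contraT => /eqP nD.
  case: C0; rewrite -(minC D) //; apply/negP=> /indepP/(_ D (subxx _) D0).
  exact: nD.
have yB' : y \notin x |: (B :\ b) by rewrite !inE (negPf nyx) (negPf yB) andbF.
have bCx := mem_fcircuit_exchange bB bB0 xB bB'.
have yCx : y \notin fcircuit M x B.
  apply/negP=> /(subsetP (fcircuit_sub bB xB)).
  by rewrite !inE (negPf nyx) (negPf yB).
have yCy := mem_fcircuit bB yB; have yC := mem_fcircuit bB' yB'.
have sC z := subsetP (fcircuit_sub bB' yB') z.
have sCx z := subsetP (fcircuit_sub bB xB) z.
have sCy z := subsetP (fcircuit_sub bB yB) z.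
have bC : b \notin fcircuit M y (x |: (B :\ b)).
  apply/negP=> /sC; rewrite !inE eqxx orbF => /orP[] /eqP bE.
    by rewrite -bE bB0 in yB.
  by rewrite -bE bB0 in xB.
pose S := symdiff (fcircuit M x B) (fcircuit M y B).
(* Each of [y] and [b] lies in exactly two of the three circuits and cancels, so this zero-sum set
   lies inside the new basis. *)
have S0 : symdiff (fcircuit M y (x |: (B :\ b))) S = set0.
  apply: (indepP _ (basis_indep bB')); last first.
    by rewrite !vsum_symdiff !circuit0 ?fcircuit_circuit ?addr0.
  apply/subsetP=> z; move/implyP: (sC z); move/implyP: (sCx z).
  move/implyP: (sCy z); rewrite !inE.
  have [->|nzy] := eqVneq z y; first by rewrite yC yCy (negPf yCx).
  have [->|nzb] := eqVneq z b; first by rewrite bCx bCy (negPf bC).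
  by do 3!case: (z \in fcircuit _ _ _); case: (z == x); case: (z \in B).
by apply/setP=> z; move/setP/(_ z): S0; rewrite !inE; do 3!case: (z \in _).
Qed.

(** * From the exchange rule to a representation *)

Section Representation.
Variables (T : finType) (M : matroid T) (n : nat) (v : T -> 'rV['F_2]_n).
Implicit Types B : {set T}.

Definition represents_at B :=
  zero_sum_free v B /\ forall y, y \notin B -> vsum v (fcircuit M y B) = 0.

Hypothesis fcircuit_exchange : forall B b x,
  basis M B -> b \in B -> x \notin B -> basis M (x |: (B :\ b)) ->
  forall y, y \notin B -> y != x -> b \in fcircuit M y B ->
  fcircuit M y (x |: (B :\ b)) = symdiff (fcircuit M x B) (fcircuit M y B).

Lemma represents_at_exchange B b x :
  basis M B -> b \in B -> x \notin B -> basis M (x |: (B :\ b)) ->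
  represents_at B -> represents_at (x |: (B :\ b)).
Proof.
move=> bB bB0 xB bB' [freeB sum0].
have nbx : b != x by apply: contraNneq xB => <-.
have bB'n : b \notin x |: (B :\ b) by rewrite !inE eqxx (negPf nbx).
have bCx := mem_fcircuit_exchange bB bB0 xB bB'.
have xCx := mem_fcircuit bB xB.
have sCx := fcircuit_sub bB xB.
split=> [D sD D0|y].
  have [xD|xD] := boolP (x \in D); last first.
    apply: freeB D0; apply/subsetP=> z zD.
    have := subsetP sD z zD; rewrite !inE => /orP[/eqP zx|/andP[]//].
    by rewrite -zx zD in xD.
  (* Adding the circuit of [x] cancels [x] and gives a zero-sum subset of [B]; it still contains
     [b], so it is not empty. *)
  have /freeB : symdiff D (fcircuit M x B) \subset B.
    apply/subsetP=> z; have := subsetP sD z; have := subsetP sCx z; rewrite !inE.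
    have [->|_ /= sCz sDz] := eqVneq z x; first by rewrite xD xCx.
    by case/orP=> /andP[_]; [case/sDz/andP | apply: sCz].
  rewrite vsum_symdiff D0 sum0 // addr0 => /(_ erefl)/setP/(_ b).
  by rewrite !inE bCx (contraNF (subsetP sD b) bB'n).
rewrite !inE negb_or negb_and negbK => /andP[nyx].
(* For [y = b] the new circuit is that of [x] in [B]. Otherwise it comes from the exchange rule if
   [b] lies in the old circuit of [y], and is that old circuit if not. *)
have [-> _|nyb /= yB] := eqVneq y b.
  rewrite -(@fcircuit_unique _ M b _ (fcircuit M x B)) ?sum0 //.
    exact: fcircuit_circuit.
  by rewrite setUCA setD1K.
have [bCy|bCy] := boolP (b \in fcircuit M y B).
  by rewrite fcircuit_exchange // vsum_symdiff !sum0 // addr0.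
rewrite -(@fcircuit_unique _ M y _ (fcircuit M y B)) ?sum0 //.
- by rewrite !inE (negPf nyx) (negPf yB) andbF.
- exact: fcircuit_circuit.
apply/subsetP=> z zC; have := subsetP (fcircuit_sub bB yB) z zC.
rewrite !inE => /orP[->//|->]; rewrite andbT.
by have -> : z != b; [apply: contraNneq bCy => <- | rewrite !orbT].
Qed.

Lemma represents_at_bases B0 B :
  basis M B0 -> basis M B -> represents_at B0 -> represents_at B.
Proof.
move=> bB0 + rB0; have [m] := ubnP #|B :\: B0|.
elim: m B => // m IHm B ltm bB.
have [BB0|[b bBB0]] := set_0Vmem (B :\: B0).
  have sBB0 : B \subset B0 by rewrite -setD_eq0 BB0.
  by have /maxsetP[_ /(_ B0 (basis_indep bB0) sBB0) <-] := bB.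
have [x xB0B bB'] := basis_exchange bB bB0 bBB0.
move: (bBB0) (xB0B); rewrite !inE => /andP[bB0n bBin] /andP[xB xB0].
have nbx : b != x by apply: contraNneq xB => <-.
(* The new basis is closer to [B0], so induction applies to it; the reverse exchange then carries
   the property back to [B]. *)
have BE : B = b |: ((x |: (B :\ b)) :\ x).
  by rewrite setU1K ?setD1K // !inE (negPf xB) andbF.
rewrite BE; apply: represents_at_exchange; rewrite -?BE //.
- exact: setU11.
- by rewrite !inE eqxx (negPf nbx).
apply: IHm => //; rewrite ltnS in ltm; apply: leq_trans ltm.
apply/proper_card/properP; split; last first.
  by exists b => //; rewrite !inE eqxx (negPf nbx) andbF.
apply/subsetP=> z; rewrite !inE => /andP[zB0 /orP[/eqP zx|/andP[_ ->]]].
  by rewrite zx xB0 in zB0.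
by rewrite zB0.
Qed.

(** An independent set inherits freeness from a basis containing it; a dependent one contains a
    circuit, which is a nonempty zero-sum set. *)
Lemma represents_at_indep B0 A :
  basis M B0 -> represents_at B0 -> indep M A = free [seq v x | x <- enum A].
Proof.
move=> bB0 rB0; apply/idP/free_zero_sum_free => [iA D sDA|freeA].
  have [B bB sAB] := maxset_exists iA.
  have [freeB _] := represents_at_bases bB0 bB rB0.
  exact/freeB/(subset_trans sDA).
apply: contraT => nA.
have [C cC sCA] := @minset_exists _ [pred A | ~~ indep M A] A nA.
have [B [e [bB eB CE]]] := circuit_fundamental cC.
have [_ /(_ e eB)] := represents_at_bases bB0 bB rB0.
rewrite -CE => /(freeA C sCA) C0.
by move: (circuit_dep cC); rewrite C0 indep0.
Qed.

End Representation.

(** * The vectors attached to a fixed basis *)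

Section BasisVectors.
Variables (T : finType) (M : matroid T) (B : {set T}).

Definition unit_vec (e : T) : 'rV['F_2]_#|T| := delta_mx 0 (enum_rank e).

Definition basis_vec (y : T) : 'rV['F_2]_#|T| :=
  if y \in B then unit_vec y else \sum_(e in fcircuit M y B :\ y) unit_vec e.

Lemma represents_at_basis_vec : basis M B -> represents_at M basis_vec B.
Proof.
move=> bB; have vsumB (D : {set T}) : D \subset B ->
    vsum basis_vec D = \sum_(e in D) unit_vec e.
  by move/subsetP=> sDB; apply: eq_bigr => e /sDB; rewrite /basis_vec => ->.
split=> [D sDB|y yB].
  rewrite vsumB // => /rowP D0; apply/setP=> z; rewrite inE; apply/negP => zD.
  (* Only the term of [z] contributes to its coordinate, which is therefore 1. *)
  have := D0 (enum_rank z); rewrite summxE (bigD1 z) //= !mxE !eqxx /=.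
  rewrite big1 ?addr0 => [/eqP|e /andP[_ nez]]; first by rewrite oner_eq0.
  by rewrite mxE (inj_eq enum_rank_inj) eq_sym (negPf nez).
rewrite /vsum (big_setD1 y) ?mem_fcircuit //= -/(vsum _ _) vsumB.
  by rewrite /basis_vec (negPf yB) addvv_F2.
by rewrite subDset; apply: fcircuit_sub.
Qed.

End BasisVectors.

Theorem theorem5p3 (T : finType) (M : matroid T) :
  binary M <->
  (forall (B : {set T}) (b x : T),
     basis M B -> b \in B -> x \notin B -> basis M (x |: (B :\ b)) ->
     forall y : T, y \notin B -> y != x -> b \in fcircuit M y B ->
       fcircuit M y (x |: (B :\ b)) =
       symdiff (fcircuit M x B) (fcircuit M y B)).
Proof.
split=> [binM B b x bB bB0 xB bB' y|exchange].
  by move=> yB nyx bCy; apply: binary_fcircuit_exchange.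
have [B bB _] := maxset_exists (indep0 M).
exists #|T|, (basis_vec M B) => A; apply: (represents_at_indep exchange) (bB) _.
exact: represents_at_basis_vec.
Qed.
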